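(* Let $I$ be a monomial ideal in $R=K[x_1,\ldots,x_n]$. If $I$ is a Lyubeznik ideal or $I$ is an almost Lyubeznik ideal, then $\mathrm{projdim}(R/I)=L(I)=ps(I)$.
   Context: $K$ is a field, $G(I)$ denotes the minimal set of monomial generators of $I$, and $\mathrm{projdim}$ denotes projective dimension over $R$. For a total order $\prec$ on $G(I)$ write $G(I)=\{m_1\prec\cdots\prec m_\mu\}$. For $A\subseteq G(I)$, $\mathrm{lcm}(A)$ is the least common multiple of the elements of $A$ and $\min(A)$ its least element under $\prec$. A symbol is $u(i_1;\ldots;i_t)$ with $1\le i_1<\cdots<i_t\le\mu$; it is $L$-admissible (of dimension $t$) if for all $h<t$ and all $q<i_h$, $m_q$ does not divide $\mathrm{lcm}(m_{i_h},\ldots,m_{i_t})$. The Lyubeznik resolution of $R/I$ with respect to $\prec$ is the free resolution with $L^0=R$, $L^t$ the free $R$-module on the $L$-admissible symbols of dimension $t$, and $$\partial_t(u(i_1;\ldots;i_t))=\sum_{j=1}^t(-1)^{j+1}\frac{\mathrm{lcm}(m_{i_1},\ldots,m_{i_t})}{\mathrm{lcm}(m_{i_1},\ldots,\widehat{m_{i_j}},\ldots,m_{i_t})}\,u(i_1;\ldots;\widehat{i_j};\ldots;i_t).$$ $L_{\prec}(I)$ is the length of this resolution (largest $t$ with $L^t\neq0$), and $L(I)=\min\{L_{\prec}(I):\prec\text{ a total order on }G(I)\}$. $I$ is a Lyubeznik ideal if for some total order on $G(I)$ the Lyubeznik resolution is a minimal free resolution of $R/I$; $I$ is an almost Lyubeznik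 ideal if $L(I)=\mathrm{projdim}(R/I)$. A (nonempty) subset $D\subseteq G(I)$ is broken under $\prec$ if there is $u\in G(I)$ with $u\mid\mathrm{lcm}(D)$ and $u\prec\min(D)$. A subset $E\subseteq G(I)$ is preserved under $\prec$ if no subset of $E$ is broken. $ps(I,\prec)=\max\{|A|: A\subseteq G(I),\ A\text{ is preserved under }\prec\}$ and $ps(I)=\min\{ps(I,\prec):\prec\text{ is a total order on }G(I)\}$. *)

(* Defs.v *)
From HB Require Import structures.
From mathcomp Require Import all_boot all_order all_algebra.
From mathcomp Require Import finmap generic_quotient ring_quotient.
From mathcomp.multinomials Require Import mpoly.
From Stdlib Require Import ClassicalEpsilon.

Set Implicit Arguments.
Unset Strict Implicit.
Unset Printing Implicit Defensive.

Import GRing.Theory.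

Local Open Scope fset_scope.
Local Open Scope ring_scope.
Local Open Scope quotient_scope.

(* The least element of [P]; unspecified when [P] is empty. *)
Definition nat_min (P : nat -> Prop) : nat :=
  epsilon (inhabits 0%N) (fun d => P d /\ forall e, P e -> (d <= e)%N).

Lemma nat_minP (P : nat -> Prop) :
  (exists d, P d) -> P (nat_min P) /\ forall e, P e -> (nat_min P <= e)%N.
Proof.
move=> [d0 Pd0]; apply: (epsilon_spec (inhabits 0%N)
  (fun d => P d /\ forall e, P e -> (d <= e)%N)).
elim/ltn_ind: d0 Pd0 => d IH Pd.
have [[e Pe ltd]|noe] :=
  excluded_middle_informative (exists2 e, P e & (e < d)%N); first exact: IH Pe.
exists d; split=> // e Pe; rewrite leqNgt; apply/negP => ltd.
by apply: noe; exists e.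
Qed.

Section QuotientModule.
Variables (R : pzRingType) (V : lmodType R) (N : submodClosed V).

(* [submodClosed V] does not canonically inherit closure under opposite, which
   the library's quotient construction needs; hence this copy of [N]. *)
Definition submod_pred : {pred V} := fun x => x \in N.

Lemma submod_pred_zmod_closed : zmod_closed submod_pred.
Proof.
split; first exact: (rpred0 N).
move=> x y xN yN; rewrite -scaleN1r; apply: (rpredD xN).
exact: rpredZ yN.
Qed.

HB.instance Definition _ :=
  GRing.isZmodClosed.Build V submod_pred submod_pred_zmod_closed.

Definition quot_mod : Type := {ideal_quot submod_pred}.

HB.instance Definition _ := GRing.Zmodule.on quot_mod.

Definition quot_proj (x : V) : quot_mod := \pi_({ideal_quot submod_pred}) x.

Definition quot_scale (a : R) (x : quot_mod) : quot_mod :=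
  quot_proj (a *: repr (x : {ideal_quot submod_pred})).

Lemma quot_projP x : exists y, quot_proj y = x.
Proof. by exists (repr (x : {ideal_quot submod_pred})); rewrite /quot_proj reprK. Qed.

Lemma quot_proj_eq x y : (quot_proj x == quot_proj y) = (x - y \in N).
Proof. by rewrite -[RHS]/(x - y \in submod_pred) Quotient.idealrBE. Qed.

Lemma quot_scaleE a x : quot_scale a (quot_proj x) = quot_proj (a *: x).
Proof.
apply/eqP; rewrite quot_proj_eq -scalerBr; apply: rpredZ.
by rewrite -quot_proj_eq /quot_proj reprK.
Qed.

Lemma quot_projD x y : quot_proj (x + y) = quot_proj x + quot_proj y.
Proof. exact: (raddfD (\pi_({ideal_quot submod_pred}))). Qed.

Lemma quot_scaleA a b x : quot_scale a (quot_scale b x) = quot_scale (a * b) x.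
Proof. by case: (quot_projP x) => y <-; rewrite !quot_scaleE scalerA. Qed.

Lemma quot_scale1 x : quot_scale 1 x = x.
Proof. by case: (quot_projP x) => y <-; rewrite quot_scaleE scale1r. Qed.

Lemma quot_scaleDr a x y :
  quot_scale a (x + y) = quot_scale a x + quot_scale a y.
Proof.
case: (quot_projP x) (quot_projP y) => x' <- [y' <-].
by rewrite -quot_projD !quot_scaleE scalerDr quot_projD.
Qed.

Lemma quot_scaleDl x a b :
  quot_scale (a + b) x = quot_scale a x + quot_scale b x.
Proof.
by case: (quot_projP x) => y <-; rewrite !quot_scaleE scalerDl quot_projD.
Qed.

HB.instance Definition _ := GRing.Zmodule_isLmodule.Build R quot_mod
  quot_scaleA quot_scale1 quot_scaleDr quot_scaleDl.

Lemma quot_proj_linear : linear quot_proj.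
Proof. by move=> a x y; rewrite quot_projD -quot_scaleE. Qed.

HB.instance Definition _ :=
  GRing.isLinear.Build R V quot_mod *:%R quot_proj quot_proj_linear.

End QuotientModule.
Section Homological.
Variable R : pzRingType.

Definition projective (P : lmodType R) : Prop :=
  forall (A B : lmodType R) (g : {linear A -> B}) (f : {linear P -> B}),
    (forall y, exists x, g x = y) -> exists h : {linear P -> A}, g \o h =1 f.

Definition exact_at (A B C : lmodType R)
    (f : {linear A -> B}) (g : {linear B -> C}) : Prop :=
  forall y, g y = 0 <-> exists x, f x = y.

Definition is_resolution (M : lmodType R) (F : nat -> lmodType R)
    (d : forall t, {linear F t.+1 -> F t}) (e : {linear F 0%N -> M}) : Prop :=
  [/\ forall y, exists x, e x = y,
      exact_at (d 0%N) e
    & forall t, exact_at (d t.+1) (d t)].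

Definition has_proj_resolution (M : lmodType R) (l : nat) : Prop :=
  exists (F : nat -> lmodType R) (d : forall t, {linear F t.+1 -> F t})
         (e : {linear F 0%N -> M}),
    [/\ forall t, projective (F t),
        is_resolution d e
      & forall t, (l < t)%N -> forall x : F t, x = 0].

(* [None] stands for an infinite projective dimension; the zero module has
   projective dimension 0. *)
Definition projdim (M : lmodType R) : option nat :=
  if excluded_middle_informative (exists l, has_proj_resolution M l)
  then Some (nat_min (has_proj_resolution M)) else None.

End Homological.

(* [r] is a (non-strict) total order on the finite set [G]; its values outside
   [G] are irrelevant. *)
Definition total_order_on (T : choiceType) (G : {fset T}) (r : rel T) : Prop :=
  [/\ {in G &, antisymmetric r}, {in G & &, transitive r} & {in G &, total r}].

Lemma total_order_onP (T : choiceType) (G : {fset T}) :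
  exists r, total_order_on G r.
Proof.
exists (fun x y => (index x G <= index y G)%N); split.
- by move=> x y xG yG /anti_leq /(congr1 (nth x G)); rewrite !nth_index.
- by move=> x y z _ _ _; apply: leq_trans.
- by move=> x y _ _; apply: leq_total.
Qed.

(* Monomials are represented by their exponents, so that [(m <= m')%MM] is
   divisibility of monomials. *)
Section MonomialIdeals.
Variables (K : fieldType) (n : nat).
Local Notation R := {mpoly K[n]}.

(* An [R]-submodule of [R] is an ideal (possibly [R] itself). *)
Implicit Type I : submodClosed R^o.

Definition generates (S : 'X_{1..n} -> Prop) I : Prop :=
  forall p : R, p \in I <->
    exists2 s : seq (R * 'X_{1..n}),
      forall x, x \in s -> S x.2 & p = \sum_(x <- s) x.1 * 'X_[x.2].

Definition monomial_ideal I : Prop := exists S, generates S I.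

Definition is_mingens I (G : {fset 'X_{1..n}}) : Prop :=
  generates (fun m => m \in G) I /\
  forall H : {fset 'X_{1..n}}, H `<` G -> ~ generates (fun m => m \in H) I.

(* G(I); see [mingensP]. *)
Definition mingens I : {fset 'X_{1..n}} :=
  epsilon (inhabits fset0) (is_mingens I).

Lemma generates_mem S I m : generates S I ->
  'X_[m] \in I <-> exists2 m', S m' & (m' <= m)%MM.
Proof.
move=> gS; split=> [/gS[s sS Xm] | [m' Sm' lem]]; last first.
  apply/gS; exists [:: ('X_[m - m'], m')]; first by move=> x /[!inE] /eqP->.
  by rewrite big_seq1 -mpolyXD submK.
have : (\sum_(x <- s) x.1 * 'X_[x.2])@_m != 0.
  by rewrite -Xm mcoeffX eqxx oner_eq0.
rewrite raddf_sum /=; have [/hasP[x xs /= nz] _ | /hasPn no] :=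
    boolP (has (fun x => (x.1 * 'X_[x.2])@_m != 0) s); last first.
  by rewrite big_seq big1 ?eqxx // => x xs; apply/eqP; have /negPn := no _ xs.
exists x.2; first exact: sS.
move: nz; rewrite -mcoeff_msupp (perm_mem (msuppMX _ _)) => /mapP[m' _ ->].
exact: lem_addr.
Qed.

Lemma dickson (T : eqType) (c : nat -> T -> nat) k (P : T -> Prop) :
  exists2 s : seq T, forall x, x \in s -> P x &
    forall x, P x ->
      exists2 y, y \in s & forall i, (i < k)%N -> (c i y <= c i x)%N.
Proof.
elim: k P => [|k IH] P.
  have [[x Px]|noP] := excluded_middle_informative (exists x, P x).
    by exists [:: x] => [y /[!inE] /eqP->|y _] //; exists x; rewrite ?inE.
  by exists [::] => // x Px; case: noP; exists x.
have [s sP sB] := IH P.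
pose N := \max_(y <- s) c k y.
have [s' s'P s'B] : exists2 s' : seq T, forall x, x \in s' -> P x &
    forall x, P x -> (c k x < N)%N ->
      exists2 y, y \in s' & forall i, (i < k.+1)%N -> (c i y <= c i x)%N.
  elim: N => [|N [s1 s1P s1B]]; first by exists [::].
  have [s2 s2P s2B] := IH (fun x => P x /\ c k x = N).
  exists (s1 ++ s2) => [x|x Px].
    by rewrite mem_cat => /orP[/s1P|/s2P[]].
  rewrite ltnS leq_eqVlt => /orP[/eqP cx | /(s1B _ Px)[y ys yx]]; last first.
    by exists y => //; rewrite mem_cat ys.
  have [y ys yx] := s2B x (conj Px cx); exists y; first by rewrite mem_cat ys orbT.
  move=> i; rewrite ltnS leq_eqVlt => /orP[/eqP->|/yx //].
  by have [_ ->] := s2P _ ys; rewrite cx.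
exists (s ++ s') => [x|x Px]; first by rewrite mem_cat => /orP[/sP|/s'P].
have [ltx|lex] := ltnP (c k x) N.
  by have [y ys yx] := s'B _ Px ltx; exists y => //; rewrite mem_cat ys orbT.
have [y ys yx] := sB _ Px; exists y; first by rewrite mem_cat ys.
move=> i; rewrite ltnS leq_eqVlt => /orP[/eqP->|/yx //].
by apply: leq_trans lex; apply: (@leq_bigmax_seq _ _ xpredT).
Qed.

Lemma mingensP I : monomial_ideal I -> is_mingens I (mingens I).
Proof.
move=> [S gS]; apply: epsilon_spec.
pose c i (m : 'X_{1..n}) : nat := if insub i is Some j then m j else 0%N.
have [s sS sB] := dickson c n S.
have {}sB m : S m -> exists2 m', m' \in s & (m' <= m)%MM.
  move=> /sB[m' m's le]; exists m' => //; apply/mnm_lepP => i.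
  by have := le i (ltn_ord i); rewrite /c valK.
pose G := [fset m in s | all (fun m' => (m' <= m)%MM ==> (m' == m)) s].
have GP m : m \in G -> m \in s /\ forall m', m' \in s -> (m' <= m)%MM -> m' = m.
  rewrite !inE => /andP[ms /allP a]; split=> // m' m's le.
  by have := a _ m's; rewrite le => /eqP.
have GB m : m \in s -> exists2 g, g \in G & (g <= m)%MM.
  elim: {m}_.+1 {-2}m (ltnSn (mdeg m)) => // k IH m ltm ms.
  have [mG|] := boolP (m \in G); first by exists m; rewrite ?lepm_refl.
  rewrite !inE ms /= => /allPn[m' m's]; rewrite negb_imply => /andP[le ne].
  have [|g gG gm'] := IH m' _ m's; last by exists g => //; apply: lepm_trans le.
  apply: (@leq_trans (mdeg m)) => //.
  rewrite -(submK le) mdegD -[X in (X < _)%N]add0n ltn_add2r lt0n mdeg_eq0.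
  apply: contraNneq ne => e0.
  by rewrite -[X in _ == X](submK le) e0 add0m.
exists G; split=> [p|H HG gHI]; last first.
  have [/fsubsetP {}HG /fsubsetPn[g gG gH]] := andP HG.
  have : 'X_[g] \in I.
    apply/(generates_mem _ gS); exists g; last exact: lepm_refl.
    by apply: sS; case: (GP _ gG).
  move=> /(generates_mem _ gHI)[h hH hg].
  have [hs _] := GP _ (HG _ hH); have [_ /(_ _ hs hg) hg'] := GP _ gG.
  by rewrite hg' in hH; rewrite hH in gH.
split=> [/gS[u uS ->] | [u uG ->]]; last first.
  apply/gS; exists u => // x /uG xG; apply: sS; by case: (GP _ xG).
elim: u uS => [|x u IH] uS.
  by exists [::]; rewrite ?big_nil.
have [|v vG vE] := IH; first by move=> y yu; apply: uS; rewrite inE yu orbT.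
have [m' /GB[g gG gm'] m'x] : exists2 m', m' \in s & (m' <= x.2)%MM.
  by apply/sB/uS; rewrite mem_head.
exists ((x.1 * 'X_[x.2 - g], g) :: v) => [y|].
  by rewrite inE => /orP[/eqP-> //|/vG].
rewrite !big_cons /= vE -mulrA -mpolyXD submK //.
exact: lepm_trans m'x.
Qed.

Section Lyubeznik.
Variables (G : {fset 'X_{1..n}}) (prec : rel 'X_{1..n}).
Local Notation mu := (#|` G|).

(* The generators are indexed from 0, in increasing order. *)
Definition gen (i : 'I_mu) : 'X_{1..n} := nth 0%MM (sort prec G) i.

Definition lcm_gens (S : {set 'I_mu}) : 'X_{1..n} :=
  \big[@mlcm n/0%MM]_(i in S) gen i.

(* The symbol u(i_1; ...; i_t) is represented by the set {i_1, ..., i_t}. *)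
Definition admissible (S : {set 'I_mu}) : bool :=
  [forall i in S, [exists j in S, (i < j)%N] ==>
    [forall q : 'I_mu, (q < i)%N ==>
      ~~ (gen q <= lcm_gens [set j in S | (i <= j)%N])%MM]].

Definition symbol (t : nat) : Type :=
  {S : {set 'I_mu} | admissible S && (#|S| == t)}.
HB.instance Definition _ t := Finite.on (symbol t).

(* For t = 0 the only symbol is the empty one, so this is R. *)
Definition lyub_mod (t : nat) : lmodType R := {ffun symbol t -> R^o}.

(* The coefficient of u(T) in the differential of u(S); the number of elements
   of S below its j-th element is j - 1, which has the parity of j + 1. *)
Definition lyub_coef (S T : {set 'I_mu}) : R :=
  \sum_(i in S | S :\ i == T)
    (-1) ^+ #|[set j in S | (j < i)%N]| * 'X_[lcm_gens S - lcm_gens (S :\ i)].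

Definition lyub_diff_fun (t : nat) (v : {ffun symbol t.+1 -> R^o}) :
    {ffun symbol t -> R^o} :=
  [ffun T => \sum_S lyub_coef (val S) (val T) * v S].

Lemma lyub_diff_linear t :
  linear (@lyub_diff_fun t : lyub_mod t.+1 -> lyub_mod t).
Proof.
move=> a v w; apply/ffunP => T; rewrite !ffunE scaler_sumr -big_split /=.
by apply: eq_bigr => S _; rewrite !ffunE mulrDr; congr (_ + _); exact: mulrCA.
Qed.

HB.instance Definition _ t :=
  GRing.isLinear.Build R (lyub_mod t.+1) (lyub_mod t) *:%R
    (@lyub_diff_fun t) (@lyub_diff_linear t).

Definition lyub_diff (t : nat) : {linear lyub_mod t.+1 -> lyub_mod t} :=
  @lyub_diff_fun t.

Definition lyub_aug_fun I (v : {ffun symbol 0 -> R^o}) : quot_mod I :=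
  quot_proj I (\sum_S v S).

Lemma lyub_aug_linear I : linear (@lyub_aug_fun I : lyub_mod 0 -> quot_mod I).
Proof.
move=> a v w; rewrite /lyub_aug_fun -linearP scaler_sumr -big_split /=.
by congr quot_proj; apply: eq_bigr => S _; rewrite !ffunE.
Qed.

HB.instance Definition _ I :=
  GRing.isLinear.Build R (lyub_mod 0) (quot_mod I) *:%R
    (@lyub_aug_fun I) (@lyub_aug_linear I).

Definition lyub_aug I : {linear lyub_mod 0 -> quot_mod I} := @lyub_aug_fun I.

(* A free module is nonzero exactly when its basis is nonempty. *)
Definition lyub_length : nat :=
  \max_(t < mu.+1 | (0 < #|{: symbol t}|)%N) t.

Definition fset_lcm (A : {fset 'X_{1..n}}) : 'X_{1..n} :=
  \big[@mlcm n/0%MM]_(m <- A) m.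

Definition fset_least (A : {fset 'X_{1..n}}) : 'X_{1..n} :=
  head 0%MM (sort prec A).

Definition broken (D : {fset 'X_{1..n}}) : bool :=
  [&& D != fset0, D `<=` G &
    has (fun u => [&& (u <= fset_lcm D)%MM, prec u (fset_least D)
                    & u != fset_least D]) G].

Definition preserved (E : {fset 'X_{1..n}}) : bool :=
  (E `<=` G) && all (fun D => ~~ broken D) (fpowerset E).

Definition ps_order : nat :=
  \max_(A <- fpowerset G | preserved A) #|` A|.

End Lyubeznik.

(* The image of each differential lies in (x_1, ..., x_n) times its target. *)
Definition minimal_complex (F : nat -> lmodType R)
    (d : forall t, {linear F t.+1 -> F t}) : Prop :=
  forall t v, exists w : 'I_n -> F t, d t v = \sum_(i < n) 'X_i *: w i.

Definition lyubeznik_ideal I : Prop :=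
  exists prec : rel 'X_{1..n},
    [/\ total_order_on (mingens I) prec,
        is_resolution (lyub_diff (mingens I) prec) (lyub_aug (mingens I) prec I)
      & minimal_complex (lyub_diff (mingens I) prec)].

Definition lyub_number I : nat :=
  nat_min (fun l => exists2 prec : rel 'X_{1..n},
    total_order_on (mingens I) prec & lyub_length (mingens I) prec = l).

Definition ps_number I : nat :=
  nat_min (fun l => exists2 prec : rel 'X_{1..n},
    total_order_on (mingens I) prec & ps_order (mingens I) prec = l).

Lemma lyub_numberP I :
  (exists2 prec, total_order_on (mingens I) prec &
     lyub_length (mingens I) prec = lyub_number I) /\
  forall prec, total_order_on (mingens I) prec ->
    (lyub_number I <= lyub_length (mingens I) prec)%N.
Proof.
have [r rP] := total_order_onP (mingens I).
have [|H minH] := @nat_minP (fun l => exists2 prec : rel 'X_{1..n},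
    total_order_on (mingens I) prec & lyub_length (mingens I) prec = l).
  by exists (lyub_length (mingens I) r); exists r.
by split=> // prec precP; apply: minH; exists prec.
Qed.

Lemma ps_numberP I :
  (exists2 prec, total_order_on (mingens I) prec &
     ps_order (mingens I) prec = ps_number I) /\
  forall prec, total_order_on (mingens I) prec ->
    (ps_number I <= ps_order (mingens I) prec)%N.
Proof.
have [r rP] := total_order_onP (mingens I).
have [|H minH] := @nat_minP (fun l => exists2 prec : rel 'X_{1..n},
    total_order_on (mingens I) prec & ps_order (mingens I) prec = l).
  by exists (ps_order (mingens I) r); exists r.
by split=> // prec precP; apply: minH; exists prec.
Qed.

Definition almost_lyubeznik_ideal I : Prop :=
  projdim (quot_mod I) = Some (lyub_number I).

End MonomialIdeals.

(* Main.v *)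
Require Import Defs.
From HB Require Import structures.
From mathcomp Require Import all_boot all_order all_algebra finmap zify.
From mathcomp.multinomials Require Import mpoly.
From Stdlib Require Import ClassicalEpsilon.
Import GRing.Theory.
Local Open Scope ring_scope.
Set Implicit Arguments.
Unset Strict Implicit.
Unset Printing Implicit Defensive.

(** Fix a total order on G(I).

    A set of generators is preserved exactly when its symbol is admissible.
    The least generator of a broken subset D starts a tail of the set whose lcm
    is a multiple of lcm(D), so D breaks the admissibility condition there;
    conversely, the tails on which admissibility fails are themselves broken.
    The only tail on which admissibility says nothing is the last singleton,
    and it is never broken because minimal generators do not divide each other.
    Hence the Lyubeznik resolution has length ps(I, <) for every order
    ([lyub_length_ps]), and taking minima gives L(I) = ps(I).  For an almost
    Lyubeznik ideal nothing else is left to prove.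

    Two facts are needed for a Lyubeznik ideal.  Every order gives a free
    resolution ([lyub_resolution]), so projdim(R/I) <= L(I).  For this, the
    complex is taken one monomial degree m at a time.  The symbols S with lcm(S)
    dividing m form a simplicial complex.  If m is in I, it is a cone: adding the
    first generator dividing m to an admissible S keeps it admissible, and the
    cone operator with that apex is a contracting homotopy.  If m is not in I,
    only the empty symbol is left, which accounts for R/I in that degree.

    Moreover no projective resolution is shorter than a minimal free resolution
    F of finite length ([minimal_lyub_length_le]).  Let P be a projective
    resolution shorter than F, and let t+1 be the length of F.  Then the identity
    of F is homotopic to a chain map factoring through P, which is 0 in degree
    t+1.  So the last differential of F has a left inverse
    ([short_resolution_splits]).  Its image lies in (x_1, ..., x_n) F_t, hence
    every vector of F_(t+1) lies in (x_1, ..., x_n) F_(t+1), which fails for a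
    basis vector.

    If the order < makes the resolution minimal, the two facts give
    L(I) <= L_<(I) <= projdim(R/I) <= L(I). *)

(** * Comparison of projective resolutions *)

Section Kernel.
Variables (R : pzRingType) (B C : lmodType R) (g : {linear B -> C}).

Definition kernel_pred : {pred B} := fun x => g x == 0.

Lemma kernel_submod_closed : submod_closed kernel_pred.
Proof.
split=> [|a x y /eqP gx /eqP gy]; first by rewrite /in_mem /= /kernel_pred linear0.
by rewrite /in_mem /= /kernel_pred linearP gx gy scaler0 addr0.
Qed.

HB.instance Definition _ :=
  GRing.isSubmodClosed.Build R B kernel_pred kernel_submod_closed.

Record kernel := Kernel { kernel_val : B; _ : kernel_val \in kernel_pred }.

HB.instance Definition _ := [isSub of kernel for kernel_val].
HB.instance Definition _ := [Choice of kernel by <:].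
HB.instance Definition _ := [SubChoice_isSubZmodule of kernel by <:].
HB.instance Definition _ := [SubZmodule_isSubLmodule of kernel by <:].
End Kernel.

Section Comparison.
Variable R : pzRingType.

(** Projectivity lifts along a surjection; exactness at [B] makes the
    corestriction of [f] to the kernel of [g] one. *)
Lemma projective_lift (P A B C : lmodType R) (f : {linear A -> B})
    (g : {linear B -> C}) (phi : {linear P -> B}) :
  projective P -> exact_at f g -> (forall x, g (phi x) = 0) ->
  exists psi : {linear P -> A}, forall x, f (psi x) = phi x.
Proof.
move=> projP exact_fg gphi.
have fK x : f x \in kernel_pred g.
  by apply/eqP/exact_fg; exists x.
have phiK x : phi x \in kernel_pred g by apply/eqP/gphi.
pose f' x : kernel g := Kernel (fK x).
pose phi' x : kernel g := Kernel (phiK x).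
have f'_lin : linear f' by move=> a x y; apply: val_inj; rewrite /= linearP.
have phi'_lin : linear phi' by move=> a x y; apply: val_inj; rewrite /= linearP.
pose f'L := HB.pack_for {linear A -> kernel g} f'
  (GRing.isLinear.Build R A (kernel g) *:%R f' f'_lin).
pose phi'L := HB.pack_for {linear P -> kernel g} phi'
  (GRing.isLinear.Build R P (kernel g) *:%R phi' phi'_lin).
have f'_surj y : exists x, f'L x = y.
  have /eqP/exact_fg[x fx] := valP y.
  by exists x; apply: val_inj.
have [psi psiE] := projP _ _ f'L phi'L f'_surj.
by exists psi => x; have := congr1 val (psiE x).
Qed.

Variables (M : lmodType R) (F G : nat -> lmodType R).
Variables (dF : forall t, {linear F t.+1 -> F t}) (eF : {linear F 0%N -> M}).
Variables (dG : forall t, {linear G t.+1 -> G t}) (eG : {linear G 0%N -> M}).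

(** The comparison theorem.  Each component of the chain map is chosen among the
    lifts of the previous one, so that the family is a plain recursion and the
    existence of a lift is only used afterwards. *)
Lemma chain_lift_exists :
    (forall t, projective (F t)) ->
    is_resolution dF eF -> is_resolution dG eG ->
  exists a : forall t, {linear F t -> G t},
    (forall x, eG (a 0%N x) = eF x) /\
    forall t x, dG t (a t.+1 x) = a t (dF t x).
Proof.
move=> projF [_ exF0 exF] [surjG exG0 exG].
pose a := fix a t : {linear F t -> G t} := match t with
  | 0 => epsilon (inhabits (\0 : {linear F 0%N -> G 0%N}))
           (fun b => forall x, eG (b x) = eF x)
  | t.+1 => epsilon (inhabits (\0 : {linear F t.+1 -> G t.+1}))
           (fun b => forall x, dG t (b x) = a t (dF t x))
  end.
have a0 x : eG (a 0%N x) = eF x.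
  move: x; apply: (epsilon_spec (inhabits _)
    (fun b : {linear F 0%N -> G 0%N} => forall x, eG (b x) = eF x)).
  exact: projF surjG.
exists a; split=> //.
have step t (phi := a t \o dF t) :
    (exists b : {linear F t.+1 -> G t.+1}, forall x, dG t (b x) = phi x) ->
    forall x, dG t (a t.+1 x) = a t (dF t x).
  exact: epsilon_spec.
elim=> [|t IH]; apply: step.
  apply: (projective_lift (projF 1%N) exG0) => x /=.
  by rewrite a0; apply/exF0; exists x.
apply: (projective_lift (projF _) (exG t)) => x /=.
rewrite IH; have -> : dF t (dF t.+1 x) = 0 by apply/exF; exists x.
exact: linear0.
Qed.

(** A chain map covering the zero map of [M] is null-homotopic. *)
Lemma null_homotopy_exists (f : forall t, {linear F t -> G t}) :
    (forall t, projective (F t)) ->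
    is_resolution dF eF -> is_resolution dG eG ->
    (forall x, eG (f 0%N x) = 0) ->
    (forall t x, dG t (f t.+1 x) = f t (dF t x)) ->
  exists h : forall t, {linear F t -> G t.+1},
    forall t x, f t.+1 x = dG t.+1 (h t.+1 x) + h t (dF t x).
Proof.
move=> projF [_ exF0 exF] [surjG exG0 exG] f0 fd.
pose h := fix h t : {linear F t -> G t.+1} := match t with
  | 0 => epsilon (inhabits (\0 : {linear F 0%N -> G 1%N}))
           (fun b => forall x, dG 0%N (b x) = f 0%N x)
  | t.+1 => epsilon (inhabits (\0 : {linear F t.+1 -> G t.+2}))
           (fun b => forall x, dG t.+1 (b x) = f t.+1 x - h t (dF t x))
  end.
have h0 x : dG 0%N (h 0%N x) = f 0%N x.
  move: x; apply: (epsilon_spec (inhabits _)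
    (fun b : {linear F 0%N -> G 1%N} => forall x, dG 0%N (b x) = f 0%N x)).
  exact: projective_lift (projF 0%N) exG0 f0.
have step t (phi := f t.+1 \- (h t \o dF t)) :
    (exists b : {linear F t.+1 -> G t.+2}, forall x, dG t.+1 (b x) = phi x) ->
    forall x, dG t.+1 (h t.+1 x) = f t.+1 x - h t (dF t x).
  exact: epsilon_spec.
suff hS t x : dG t.+1 (h t.+1 x) = f t.+1 x - h t (dF t x).
  by exists h => t x; rewrite hS subrK.
elim: t x => [|t IH]; apply: step; apply: (projective_lift (projF _) (exG _)) => x /=.
  by rewrite linearB fd h0 subrr.
have -> : dG t.+1 (f t.+2 x - h t.+1 (dF t.+1 x))
   = f t.+1 (dF t.+1 x) - dG t.+1 (h t.+1 (dF t.+1 x)) by rewrite linearB fd.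
rewrite IH; have -> : dF t (dF t.+1 x) = 0 by apply/exF; exists x.
by rewrite linear0 subr0 subrr.
Qed.

End Comparison.

(** A resolution by projectives that ends in degree [t.+1], for a module with a
    projective resolution of length at most [t], splits at its end.  The chain
    maps to the short resolution and back compose to a map that is 0 in degree
    [t.+1] and homotopic to the identity; there the homotopy is reduced to its
    term on [F t], as [F t.+2] vanishes. *)
Lemma short_resolution_splits (R : pzRingType) (M : lmodType R)
    (F : nat -> lmodType R) (d : forall t, {linear F t.+1 -> F t})
    (e : {linear F 0%N -> M}) (l t : nat) :
    (forall s, projective (F s)) -> is_resolution d e ->
    has_proj_resolution M l -> (l <= t)%N -> (forall x : F t.+2, x = 0) ->
  exists h : {linear F t -> F t.+1}, forall x, h (d t x) = x.
Proof.
move=> projF resF [P [dP [eP [projP resP P0]]]] le_lt F0.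
have [a [a0 ad]] := chain_lift_exists projF resF resP.
have [b [b0 bd]] := chain_lift_exists projP resP resF.
pose f s : {linear F s -> F s} := (idfun \- (b s \o a s)).
have f0 x : e (f 0%N x) = 0 by rewrite /f /= linearB b0 a0 subrr.
have fd s x : d s (f s.+1 x) = f s (d s x) by rewrite /f /= linearB bd ad.
have [h hE] := null_homotopy_exists projF resF resF f0 fd.
exists (h t) => x; have := hE t x.
by rewrite /f /= (P0 _ _ (a t.+1 x)) // linear0 subr0 (F0 (h t.+1 x)) linear0 add0r.
Qed.

Lemma free_projective (R : pzRingType) (T : finType) :
  projective ({ffun T -> R^o} : lmodType R).
Proof.
move=> A B g f g_surj.
pose b (s : T) : {ffun T -> R^o} := [ffun s' => (s' == s)%:R].
have [a aE] := fin_all_exists (fun s : T => g_surj (f (b s))).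
pose h (v : {ffun T -> R^o}) : A := \sum_s (v s : R) *: a s.
have h_lin : linear h.
  move=> c v w; rewrite /h scaler_sumr -big_split; apply: eq_bigr => s _.
  by rewrite !ffunE scalerDl scalerA.
exists (HB.pack_for {linear {ffun T -> R^o} -> A} h
  (GRing.isLinear.Build R {ffun T -> R^o} A *:%R h h_lin)) => v /=.
rewrite /h linear_sum /=; transitivity (f (\sum_s (v s : R) *: b s)).
  by rewrite linear_sum; apply: eq_bigr => s _; rewrite !linearZ_LR /= aE.
congr (f _); apply/ffunP => s; rewrite sum_ffunE (bigD1 s) //= !ffunE eqxx.
rewrite big1 ?addr0 => [|i ne]; first exact: mulr1.
by rewrite !ffunE eq_sym (negPf ne); apply: mulr0.
Qed.

(** * The Taylor complex and its contraction *)

(** The cancellation behind a simplicial boundary squaring to zero: removing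
    [i] then [k], or [k] then [i], contributes opposite terms. *)
Lemma alternating_sum0 (V : zmodType) (n : nat) (f : 'I_n -> 'I_n -> V)
    (S : {set 'I_n}) :
  (forall i k, i \in S -> k \in S -> (k < i)%N -> f k i = - f i k) ->
  \sum_(i in S) \sum_(k in S :\ i) f i k = 0.
Proof.
move=> alt; transitivity (\sum_(i in S) (\sum_(k in S | (k < i)%N) f i k
                                         + \sum_(k in S | (i < k)%N) f i k)).
  apply: eq_bigr => i iS; rewrite (bigID (fun k : 'I_n => (k < i)%N)) /=.
  congr (_ + _); apply: eq_bigl => k; rewrite !inE -val_eqE /=; lia.
rewrite big_split /= (exchange_big_dep (fun k => k \in S)) /=;
  last by move=> ? ? ? /andP[].
rewrite -big_split big1 //= => i iS.
rewrite (eq_bigl (fun k => (k \in S) && (i < k)%N)) => [|k]; last by rewrite iS.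
rewrite -big_split big1 //= => k /andP[kS lt].
by rewrite (alt _ _ kS iS lt) subrr.
Qed.

Section MonomialExtension.
Variables (K : fieldType) (n : nat) (V : lmodType {mpoly K[n]}).
Implicit Types (f : 'X_{1..n} -> V) (p q : {mpoly K[n]}).

(** The K-linear extension of a map given on monomials; an R-module is seen as a
    K-space through the constant polynomials. *)
Definition monomial_ext f p : V := \sum_(a <- msupp p) (p@_a)%:MP *: f a.

(** The two supports of a sum differ from the support of the sum; summing over
    any larger list makes linearity termwise. *)
Lemma monomial_extE f p (s : seq 'X_{1..n}) :
  uniq s -> {subset msupp p <= s} ->
  monomial_ext f p = \sum_(a <- s) (p@_a)%:MP *: f a.
Proof.
move=> s_uniq sub; rewrite [RHS](bigID (mem (msupp p))) /= [X in _ + X]big1.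
  rewrite addr0 -big_filter; apply: perm_big; apply: uniq_perm.
  - exact: msupp_uniq.
  - exact: filter_uniq.
  move=> a; rewrite mem_filter /= andbC.
  by case: (boolP (a \in msupp p)) => [/sub->|]; rewrite ?andbF.
by move=> a /memN_msupp_eq0->; rewrite mpolyC0 scale0r.
Qed.

Lemma monomial_extP f (c : K) p q :
  monomial_ext f (c *: p + q) = c%:MP *: monomial_ext f p + monomial_ext f q.
Proof.
pose s := undup (msupp p ++ msupp q).
have s_uniq : uniq s by apply: undup_uniq.
rewrite !(monomial_extE f s_uniq) => [|a|a|a]; first last.
- rewrite mem_undup mem_cat; apply: contraLR; rewrite negb_or => /andP[ap aq].
  by rewrite mcoeff_msupp negbK linearP /= !memN_msupp_eq0 // mulr0 addr0.
- by rewrite mem_undup mem_cat => ->.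
- by rewrite mem_undup mem_cat => ->; rewrite orbT.
rewrite scaler_sumr -big_split; apply: eq_bigr => a _.
by rewrite linearP /= mpolyCD mpolyCM scalerDl scalerA.
Qed.

Lemma monomial_ext0 f : monomial_ext f 0 = 0.
Proof. by rewrite /monomial_ext msupp0 big_nil. Qed.

Lemma monomial_extX f a : monomial_ext f 'X_[a] = f a.
Proof. by rewrite /monomial_ext msuppX big_seq1 mcoeffX eqxx scale1r. Qed.

End MonomialExtension.

Lemma lem0m n (m : 'X_{1..n}) : (0 <= m)%MM.
Proof. by apply/mnm_lepP => i; rewrite mnm0E. Qed.

Section Taylor.
Variables (K : fieldType) (n : nat) (G : {fset 'X_{1..n}}) (prec : rel 'X_{1..n}).
Local Notation R := {mpoly K[n]}.
Local Notation mu := (#|` G|).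
Local Notation face := {set 'I_mu}.
Local Notation gen := (@gen n G prec).
Local Notation lcm := (@lcm_gens n G prec).

Lemma gen_in (i : 'I_mu) : gen i \in G.
Proof. by rewrite /Defs.gen -(mem_sort prec) mem_nth ?size_sort. Qed.

Lemma gen_onto m : m \in G -> exists i, gen i = m.
Proof.
rewrite -(mem_sort prec) => mG.
have lt : (index m (sort prec G) < mu)%N by rewrite -(size_sort prec) index_mem.
by exists (Ordinal lt); rewrite /Defs.gen nth_index.
Qed.

Lemma gen_inj : injective gen.
Proof.
move=> i j /eqP; rewrite /Defs.gen nth_uniq ?size_sort ?sort_uniq ?fset_uniq //.
by move=> /eqP/val_inj.
Qed.

Lemma lcm_gens_le (S : face) m : (lcm S <= m)%MM = [forall i in S, (gen i <= m)%MM].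
Proof.
rewrite /lcm_gens (big_morph (fun x => (x <= m)%MM) (lem_mlcm m) (lem0m m)).
exact: big_andE.
Qed.

Lemma lcm_gensP (S : face) m :
  reflect (forall i, i \in S -> (gen i <= m)%MM) (lcm S <= m)%MM.
Proof. by rewrite lcm_gens_le; apply: forall_inP. Qed.

Lemma gen_le_lcm (S : face) i : i \in S -> (gen i <= lcm S)%MM.
Proof. by move: i; apply/lcm_gensP/lepm_refl. Qed.

Lemma lcm_gensS (S T : face) : S \subset T -> (lcm S <= lcm T)%MM.
Proof. by move=> /subsetP ST; apply/lcm_gensP => i /ST; apply: gen_le_lcm. Qed.

(** Chains of the Taylor complex: all sets of generators are allowed, in all
    dimensions at once.  The Lyubeznik modules embed in it, which avoids carrying
    proofs of admissibility through the computations. *)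
Definition chain : lmodType R := {ffun face -> R^o}.

Definition bdry_fun (v : {ffun face -> R^o}) : {ffun face -> R^o} :=
  [ffun T => \sum_S lyub_coef K prec S T * v S].

Lemma bdry_linear : linear (bdry_fun : chain -> chain).
Proof.
move=> a v w; apply/ffunP => T; rewrite !ffunE scaler_sumr -big_split /=.
by apply: eq_bigr => S _; rewrite !ffunE mulrDr; congr (_ + _); exact: mulrCA.
Qed.

HB.instance Definition _ :=
  GRing.isLinear.Build R chain chain *:%R bdry_fun bdry_linear.

Definition bdry : {linear chain -> chain} := bdry_fun.

Definition sgn (S : face) (i : 'I_mu) : R := (-1) ^+ #|[set j in S | (j < i)%N]|.

Definition single (S : face) : chain := [ffun T => (T == S)%:R].

(** The K-basis of the chains in degree [m]: the multiple of the symbol of [S]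
    that has multidegree [m].  On these the boundary is the simplicial one.
    Locked, since unification would otherwise unfold it to compare scalars. *)
Definition cell (m : 'X_{1..n}) (S : face) : chain :=
  locked ('X_[m - lcm S] *: single S).

Lemma chain_sum (v : chain) : v = \sum_S (v S : R) *: single S.
Proof.
apply/ffunP => T; rewrite sum_ffunE (bigD1 T) //= big1 => [|S neS].
  by rewrite !ffunE eqxx addr0; apply/esym/mulr1.
by rewrite !ffunE eq_sym (negPf neS); apply: mulr0.
Qed.

Lemma bdryE (v : chain) T : bdry v T = \sum_S lyub_coef K prec S T * v S.
Proof. by rewrite ffunE. Qed.

Lemma chain_scaleE (a : R) (v : chain) T : (a *: v) T = a * (v T : R).
Proof. by rewrite ffunE. Qed.

Lemma cellE m S T :
  cell m S T = if T == S then 'X_[m - lcm S] else 0.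
Proof.
by rewrite /cell -lock chain_scaleE ffunE; case: eqP => _; rewrite ?mulr1 ?mulr0.
Qed.

Lemma bdry_cell m (S : face) : (lcm S <= m)%MM ->
  bdry (cell m S) = \sum_(i in S) sgn S i *: cell m (S :\ i).
Proof.
move=> le; apply/ffunP => T; rewrite sum_ffunE bdryE.
rewrite (bigD1 S) //= [X in _ + X]big1 => [|U neU]; last first.
  by rewrite cellE (negPf neU) mulr0.
rewrite cellE eqxx addr0 /lyub_coef mulr_suml big_mkcondr.
apply: eq_bigr => i iS; rewrite chain_scaleE cellE eq_sym.
case: eqP => _; last by rewrite mulr0.
rewrite -mulrA -mpolyXD; congr (_ * 'X_[_]).
move: le (lcm_gensS (subsetDl S [set i])); move: (lcm S) (lcm (S :\ i)) => a b.
move=> /mnm_lepP am /mnm_lepP ba; apply/mnmP => k.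
by rewrite mnmDE !mnmBE addnC addnBA // subnK.
Qed.

(** When [k] comes before [i], removing [k] changes the sign attached to [i], but
    removing [i] does not change the sign attached to [k]. *)
Lemma sgn_swap (S : face) (i k : 'I_mu) : k \in S -> (k < i)%N ->
  sgn S k * sgn (S :\ k) i = - (sgn S i * sgn (S :\ i) k).
Proof.
move=> kS lt; rewrite /sgn.
have -> : [set j in S :\ i | (j < k)%N] = [set j in S | (j < k)%N].
  apply/setP => j; rewrite !inE; case: eqP => //= ->.
  by rewrite [(i < k)%N]ltnNge (ltnW lt) andbF.
rewrite (cardsD1 k [set j in S | (j < i)%N]) !inE kS lt /= exprS mulN1r mulNr.
rewrite opprK mulrC; congr (_ ^+ _ * _).
by apply: eq_card => j; rewrite !inE andbA.
Qed.

Lemma bdry_bdry_cell m (S : face) : (lcm S <= m)%MM -> bdry (bdry (cell m S)) = 0.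
Proof.
move=> le; rewrite bdry_cell // linear_sum.
pose f i k := (sgn S i * sgn (S :\ i) k) *: cell m (S :\ i :\ k).
transitivity (\sum_(i in S) \sum_(k in S :\ i) f i k).
  apply: eq_bigr => i iS; rewrite linearZ_LR bdry_cell; last first.
    exact: lepm_trans (lcm_gensS (subsetDl _ _)) le.
  by rewrite scaler_sumr; apply: eq_bigr => k _; rewrite scalerA.
apply: alternating_sum0 => i k iS kS lt; rewrite /f (sgn_swap kS lt) scaleNr.
by rewrite (_ : S :\ k :\ i = S :\ i :\ k) // !setDDl setUC.
Qed.

Lemma bdry_bdry (v : chain) : bdry (bdry v) = 0.
Proof.
rewrite [v]chain_sum !linear_sum big1 //= => S _.
(* In its own degree the basis vector has coefficient 'X_[0] = 1. *)
have -> : single S = cell (lcm S) S.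
  by rewrite /cell -lock -{1}[lcm S]add0m addmK mpolyX0 scale1r.
by rewrite !linearZ_LR /= bdry_bdry_cell ?scaler0 ?lepm_refl.
Qed.

Definition least (m : 'X_{1..n}) : option 'I_mu :=
  [pick j | (gen j <= m)%MM & [forall q, (gen q <= m)%MM ==> (j <= q)%N]].

Lemma leastP m i : (gen i <= m)%MM ->
  exists2 j, least m = Some j &
    (gen j <= m)%MM /\ forall q, (gen q <= m)%MM -> (j <= q)%N.
Proof.
move=> im; rewrite /least; case: pickP => [j /andP[jm /forall_inP min]|none].
  by exists j.
have [j jm min] := @arg_minnP _ i (fun j => gen j <= m)%MM val im.
by have /negP[] := none j; rewrite /= jm; apply/forall_inP.
Qed.

(** The cone over [S] with apex the first generator dividing [m].  It is 0 when
    [S] contains the apex. *)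
Definition cone_cell (m : 'X_{1..n}) (S : face) : chain :=
  if least m is Some j then if j \in S then 0 else cell m (j |: S) else 0.

(** The apex depends on the degree, so this map is K-linear but not R-linear. *)
Definition cone_fun (v : chain) : chain :=
  \sum_S monomial_ext (fun a => cone_cell (a + lcm S) S) (v S).

Lemma cone_funP c v w : cone_fun (c%:MP *: v + w) = c%:MP *: cone_fun v + cone_fun w.
Proof.
rewrite /cone_fun scaler_sumr -big_split; apply: eq_bigr => S _ /=.
by rewrite -monomial_extP !ffunE -mul_mpolyC.
Qed.

Lemma cone_zmod_morphism : zmod_morphism cone_fun.
Proof.
move=> v w; rewrite addrC -scaleN1r -mpolyC1 -mpolyCN cone_funP.
by rewrite mpolyCN mpolyC1 scaleN1r addrC.
Qed.

HB.instance Definition _ :=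
  GRing.isZmodMorphism.Build chain chain cone_fun cone_zmod_morphism.

Definition cone : {additive chain -> chain} := cone_fun.

Lemma coneZ c v : cone (c%:MP *: v) = c%:MP *: cone v.
Proof. by have := cone_funP c v 0; rewrite addr0 [cone_fun 0](raddf0 cone) addr0. Qed.

Lemma cone_cellE m S : (lcm S <= m)%MM -> cone (cell m S) = cone_cell m S.
Proof.
move=> le; rewrite /cone /= /cone_fun (bigD1 S) //= big1 ?addr0 => [|T neT].
  by rewrite cellE eqxx monomial_extX submK.
by rewrite cellE (negPf neT) monomial_ext0.
Qed.

Lemma sgn_least (S : face) (j : 'I_mu) : (forall i, i \in S -> (j <= i)%N) -> sgn S j = 1.
Proof.
move=> min; rewrite /sgn (_ : [set _ in _ | _] = set0) ?cards0 //.
apply/setP => i; rewrite !inE; apply/negP => /andP[/min le lt].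
by move: (leq_trans lt le); rewrite ltnn.
Qed.

Lemma sgn_addl (S : face) (i j : 'I_mu) : j \notin S -> (j < i)%N ->
  sgn (j |: S) i = - sgn S i.
Proof.
move=> jS lt; rewrite /sgn (cardsD1 j) !inE eqxx lt exprS mulN1r; congr (- _ ^+ _).
apply: eq_card => k; rewrite !inE; case: eqP => //= ->.
by rewrite (negPf jS).
Qed.

(** In degree [m] the homotopy formula is that of a simplicial cone with apex
    [j].  If [j] is in [S], the only face of [S] with a nonzero cone is the one
    without [j], whose cone is [S].  Otherwise the face of [j |: S] without [j]
    is [S], and the others cancel against the cones of the faces of [S], since
    an additional first vertex changes all signs.  The empty set is excluded: no
    generator need divide [m]. *)
Lemma cone_homotopy_cell m (S : face) : S != set0 -> (lcm S <= m)%MM ->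
  bdry (cone (cell m S)) + cone (bdry (cell m S)) = cell m S.
Proof.
move=> /set0Pn[i0 i0S] le.
have Sm i : i \in S -> (gen i <= m)%MM by move: i; apply/lcm_gensP.
have [j jE [jm jmin]] := leastP (Sm _ i0S).
have jS i : i \in S -> (j <= i)%N by move=> /Sm; apply: jmin.
rewrite cone_cellE // (bdry_cell le) raddf_sum.
have coneE i : i \in S ->
    cone (sgn S i *: cell m (S :\ i)) = sgn S i *: cone_cell m (S :\ i).
  move=> iS; rewrite raddfZsign cone_cellE //.
  exact: lepm_trans (lcm_gensS (subsetDl _ _)) le.
rewrite (eq_bigr _ coneE) /cone_cell jE.
have [jinS|jnotS] := boolP (j \in S).
  rewrite linear0 add0r (bigD1 j) //= big1 => [|i /andP[iS ne]].
    by rewrite addr0 !inE eqxx /= setD1K // sgn_least // scale1r.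
  by rewrite !inE eq_sym ne jinS scaler0.
rewrite bdry_cell; last first.
  by apply/lcm_gensP => i; rewrite !inE => /predU1P[->|/Sm].
rewrite big_setU1 //= setU1K // sgn_least ?scale1r; last first.
  by move=> i; rewrite !inE => /predU1P[->|/jS].
rewrite -addrA -big_split big1 ?addr0 // => i iS /=.
have neq : j != i by apply: contraNneq jnotS => ->.
have lt : (j < i)%N by rewrite ltn_neqAle neq jS.
rewrite !inE (negPf jnotS) andbF sgn_addl //.
rewrite (_ : (j |: S) :\ i = j |: S :\ i) ?scaleNr ?addNr //.
by apply/setP => k; rewrite !inE; case: (k =P j) => // ->; rewrite neq.
Qed.

Lemma chain_cells (v : chain) :
  v = \sum_S \sum_(a <- msupp (v S)) ((v S)@_a)%:MP *: cell (a + lcm S) S.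
Proof.
rewrite {1}[v]chain_sum; apply: eq_bigr => S _.
rewrite {1}[v S : R]mpolyE scaler_suml; apply: eq_bigr => a _.
by rewrite /cell -lock addmK scalerA mul_mpolyC.
Qed.

Lemma cone_homotopy (v : chain) : v set0 = 0 ->
  bdry (cone v) + cone (bdry v) = v.
Proof.
move=> v0; pose phi : {additive chain -> chain} := (bdry \o cone) \+ (cone \o bdry).
rewrite -[LHS]/(phi v) [in LHS](chain_cells v) [RHS](chain_cells v) raddf_sum.
apply: eq_bigr => S _; have [->|S0] := eqVneq S set0.
  by rewrite v0 msupp0 !big_nil raddf0.
rewrite raddf_sum; apply: eq_bigr => a _.
rewrite -{2}(cone_homotopy_cell S0 (lem_addl a (lcm S))).
by rewrite -[LHS]/(bdry (cone _) + cone (bdry _)) linearZ_LR !coneZ linearZ_LR scalerDr.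
Qed.

End Taylor.

(** * Exactness of the Lyubeznik complex *)

Section Lyubeznik.
Variables (K : fieldType) (n : nat) (G : {fset 'X_{1..n}}) (prec : rel 'X_{1..n}).
Local Notation R := {mpoly K[n]}.
Local Notation mu := (#|` G|).
Local Notation face := {set 'I_mu}.
Local Notation gen := (@gen n G prec).
Local Notation lcm := (@lcm_gens n G prec).
Local Notation admissible := (@admissible n G prec).
Local Notation chain := (chain K G).
Local Notation bdry := (@bdry K n G prec).
Local Notation cone := (@cone K n G prec).
Local Notation lyub t := ({ffun symbol G prec t -> R^o}).
Local Notation diff := (@lyub_diff_fun K n G prec _).

Lemma admissibleP (S : face) :
  reflect (forall i k q : 'I_mu, i \in S -> k \in S -> (i < k)%N -> (q < i)%N ->
             ~~ (gen q <= lcm [set j in S | (i <= j)%N])%MM)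
          (admissible S).
Proof.
apply: (iffP forall_inP) => [adm i k q iS kS ik qi|adm i iS].
  have /implyP/(_ _)/forall_inP := adm i iS; apply=> //.
  by apply/exists_inP; exists k.
apply/implyP => /exists_inP[k kS ik]; apply/forall_inP => q qi.
exact: adm ik qi.
Qed.

Lemma admissible_sub (S T : face) : T \subset S -> admissible S -> admissible T.
Proof.
move=> TS /admissibleP adm; apply/admissibleP => i k q iT kT ik qi.
have /negP nle := adm i k q (subsetP TS _ iT) (subsetP TS _ kT) ik qi.
apply/negP => le; apply: nle; apply: lepm_trans le _; apply: lcm_gensS.
by apply/subsetP => j; rewrite !inE => /andP[/(subsetP TS)->].
Qed.

(** The reason why the Lyubeznik symbols suffice: the tail starting at the new
    first element [j] has an lcm dividing [m], and no generator before [j]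
    divides [m].  The tails starting after [j] are those of [S]. *)
Lemma admissible_cone (S : face) m j : admissible S -> (lcm S <= m)%MM ->
  (gen j <= m)%MM -> (forall q, (gen q <= m)%MM -> (j <= q)%N) ->
  admissible (j |: S).
Proof.
move=> /admissibleP adm Sm jm jmin; apply/admissibleP => i k q.
move=> /setU1P ijS /setU1P kjS ik qi; apply/negP => le.
have jS l : l \in S -> (j <= l)%N by move=> /(lcm_gensP _ _ _ Sm)/jmin.
have [ij|nij] := eqVneq i j.
  move: qi; rewrite ij ltnNge jmin //; apply: lepm_trans le _.
  apply/lcm_gensP => l; rewrite !inE.
  by case/andP => /predU1P[->|/(lcm_gensP _ _ _ Sm)].
have iS : i \in S by case: ijS => // ij; rewrite ij eqxx in nij.
have ji : (j < i)%N by rewrite ltn_neqAle eq_sym nij jS.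
have kS : k \in S by case: kjS => // kj; move: (ltn_trans ji ik); rewrite kj ltnn.
have /negP[] := adm i k q iS kS ik qi; apply: lepm_trans le _; apply: lcm_gensS.
apply/subsetP => l; rewrite !inE => /andP[/predU1P[->|-> //]].
by rewrite leqNgt ji.
Qed.

Definition lyub_face t (S : face) := admissible S && (#|S| == t).

Definition supported t (v : chain) := forall S, ~~ lyub_face t S -> v S = 0.

Definition extend t (v : lyub t) : chain :=
  [ffun S => oapp v 0 (insub S : option (symbol G prec t))].

Definition restrict t (w : chain) : lyub t := [ffun s => w (val s)].

Lemma extend_val t (v : lyub t) s : extend v (val s) = v s.
Proof. by rewrite ffunE valK. Qed.

Lemma extend_supported t (v : lyub t) : supported t (extend v).
Proof. by move=> S nS; rewrite ffunE insubN. Qed.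

Lemma extend_inj t : injective (@extend t).
Proof. by move=> v w vw; apply/ffunP => s; rewrite -!extend_val vw. Qed.

Lemma extend0 t : extend (0 : lyub t) = 0.
Proof. by apply/ffunP => S; rewrite !ffunE; case: insub => //= s; rewrite ffunE. Qed.

Lemma restrictK t w : supported t w -> extend (restrict t w) = w.
Proof.
move=> sup; apply/ffunP => S; have [lS|nS] := boolP (lyub_face t S).
  by rewrite -[S]/(val (Sub S lS : symbol G prec t)) extend_val ffunE.
by rewrite sup // extend_supported.
Qed.

Lemma lyub_face_bdry t (S : face) i :
  lyub_face t.+1 S -> i \in S -> lyub_face t (S :\ i).
Proof.
move=> /andP[adm card] iS; rewrite /lyub_face (admissible_sub _ adm) ?subsetDl //=.
by move: card; rewrite (cardsD1 i) iS.
Qed.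

(** Faces of admissible symbols are admissible, so the boundary of an embedded
    chain has no component outside the Lyubeznik complex. *)
Lemma bdry_extend t (v : lyub t.+1) : bdry (extend v) = extend (diff v).
Proof.
apply/ffunP => T; rewrite bdryE; have [lT|nT] := boolP (lyub_face t T); last first.
  rewrite extend_supported // big1 // => S _.
  have [lS|nS] := boolP (lyub_face t.+1 S); last by rewrite extend_supported // mulr0.
  rewrite /lyub_coef big_pred0 ?mul0r // => i; apply/negP => /andP[iS /eqP SiT].
  by move: nT; rewrite -SiT (lyub_face_bdry lS).
rewrite -[T]/(val (Sub T lT : symbol G prec t)) extend_val ffunE.
rewrite (bigID (lyub_face t.+1)) /= [X in _ + X]big1 ?addr0 => [|S nS]; last first.
  by rewrite extend_supported // mulr0.
rewrite (reindex_omap (val : symbol G prec t.+1 -> face) insub) => [|S lS];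
  last by rewrite insubT.
apply: eq_big => [s|s _]; last by rewrite extend_val.
by rewrite (valP s : lyub_face t.+1 (val s)) valK eqxx.
Qed.

(** The contraction of the Taylor complex restricts to the Lyubeznik complex. *)
Lemma cone_supported t v : supported t v -> supported t.+1 (cone v).
Proof.
move=> sup T nT; rewrite /cone /= /cone_fun sum_ffunE big1 // => S _.
have [/andP[adm /eqP card]|nS] := boolP (lyub_face t S); last first.
  by rewrite sup // monomial_ext0 ffunE.
rewrite /monomial_ext sum_ffunE big1 // => a _; rewrite chain_scaleE /cone_cell /least.
case: pickP => [j /andP[jm /forall_inP jmin]|_]; last by rewrite ffunE mulr0.
have [_|jS] := boolP (j \in S); first by rewrite ffunE mulr0.
rewrite cellE; case: eqP => [TE|_]; last by rewrite mulr0.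
move: nT; rewrite TE /lyub_face cardsU1 jS card eqxx andbT.
by rewrite (admissible_cone adm (lem_addl a _) jm jmin).
Qed.

Lemma lyub_exact t :
  exact_at (@lyub_diff K n G prec t.+1) (@lyub_diff K n G prec t).
Proof.
move=> y; split=> [dy|[x <-]]; last first.
  by apply: extend_inj; rewrite /= -!bdry_extend bdry_bdry extend0.
exists (restrict _ (cone (extend y))); apply: extend_inj.
rewrite -bdry_extend restrictK; last exact/cone_supported/extend_supported.
rewrite -[RHS](cone_homotopy prec); last first.
  by rewrite extend_supported // /lyub_face cards0 andbF.
by rewrite bdry_extend [diff y]dy extend0 (raddf0 cone) addr0.
Qed.

Lemma lyub_face0 : lyub_face 0 set0.
Proof.
rewrite /lyub_face cards0 eqxx andbT.
by apply/admissibleP => i k q; rewrite inE.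
Qed.

Lemma lyub_face1 i : lyub_face 1 [set i].
Proof.
rewrite /lyub_face cards1 eqxx andbT.
by apply/admissibleP => j k q; rewrite !inE => /eqP-> /eqP->; rewrite ltnn.
Qed.

Definition empty_symbol : symbol G prec 0 := Sub set0 lyub_face0.
Definition vertex i : symbol G prec 1 := Sub [set i] (lyub_face1 i).

Lemma empty_symbolP s : s = empty_symbol.
Proof.
apply: val_inj; have /andP[_ /eqP/cards0_eq] := valP s.
by move=> ->.
Qed.

Lemma vertexP (s : symbol G prec 1) : exists i, s = vertex i.
Proof.
have /andP[_ /cards1P[i si]] := valP s.
by exists i; apply: val_inj.
Qed.

Lemma lyub_coef_vertex i : lyub_coef K prec [set i] set0 = 'X_[gen i].
Proof.
rewrite /lyub_coef (big_pred1 i) => [|k]; last first.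
  by rewrite !inE; case: (k =P i) => //= ->; rewrite setDv eqxx.
have -> : [set j in [set i] | (j < i)%N] = set0.
  by apply/setP => j; rewrite !inE; case: eqP => //= ->; rewrite ltnn.
rewrite cards0 mul1r setDv {2}/lcm_gens big_set0; congr 'X_[_].
have /mnm_lepP le1 : (lcm [set i] <= gen i)%MM.
  by apply/lcm_gensP => k; rewrite inE => /eqP->; apply: lepm_refl.
have /mnm_lepP le2 : (gen i <= lcm [set i])%MM by apply/gen_le_lcm/set11.
by apply/mnmP => k; rewrite mnmBE mnm0E subn0; apply/eqP; rewrite eqn_leq le1 le2.
Qed.

Variables (I : submodClosed R^o) (gensI : generates (fun m => m \in G) I).

Lemma lyub_aug0 (v : lyub_mod K G prec 0) :
  lyub_aug G prec I v = 0 <-> (v empty_symbol : R^o) \in I.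
Proof.
rewrite -[lyub_aug _ _ _ _]/(quot_proj I (\sum_s v s)) -(linear0 (quot_proj I)).
have -> : \sum_s v s = v empty_symbol.
  by apply: big_pred1 => s; rewrite [s]empty_symbolP; apply/esym/eqxx.
by split=> [/eqP|vI]; [|apply/eqP]; rewrite quot_proj_eq subr0.
Qed.

Lemma lyub_diff_empty (x : lyub 1) :
  lyub_diff_fun x empty_symbol = \sum_S lyub_coef K prec (val S) set0 * x S.
Proof. by rewrite ffunE. Qed.

Lemma vertex_boundary (i : 'I_mu) (a : R) : exists x : lyub_mod K G prec 1,
  lyub_diff K G prec 0 x empty_symbol = a * 'X_[gen i].
Proof.
exists [ffun s => if s == vertex i then a else 0].
rewrite [LHS]lyub_diff_empty (bigD1 (vertex i)) //= big1 => [|s ne].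
  by rewrite ffunE eqxx lyub_coef_vertex addr0 mulrC.
by rewrite ffunE (negPf ne) mulr0.
Qed.

(** In degree 1 the symbols are the single generators, each sent to its
    monomial, so the image of the differential is the ideal. *)
Lemma lyub_exact0 : exact_at (lyub_diff K G prec 0) (lyub_aug G prec I).
Proof.
move=> v; split=> [/lyub_aug0/gensI[s sG vE]|[x <-]].
  suff [x xE] : exists x : lyub_mod K G prec 1,
      lyub_diff K G prec 0 x empty_symbol = v empty_symbol.
    by exists x; apply/ffunP => u; rewrite [u]empty_symbolP.
  rewrite vE; elim: s sG {vE} => [|[a m] s IH] sG.
    by exists 0; rewrite linear0 ffunE big_nil.
  have [x xE] : exists x : lyub_mod K G prec 1,
      lyub_diff K G prec 0 x empty_symbol = \sum_(y <- s) y.1 * 'X_[y.2].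
    by apply: IH => y ys; apply: sG; rewrite inE ys orbT.
  have [i iE] := gen_onto prec (sG _ (mem_head _ _)).
  have [y yE] := vertex_boundary i a.
  by exists (y + x); rewrite linearD ffunE xE yE big_cons iE.
apply/lyub_aug0; rewrite [_ empty_symbol]lyub_diff_empty; apply: rpred_sum => s _.
have [i ->] := vertexP s; rewrite lyub_coef_vertex mulrC.
apply: (rpredZ (x _ : R)); apply/(generates_mem _ gensI).
by exists (gen i); [apply: gen_in | apply: lepm_refl].
Qed.

Theorem lyub_resolution :
  is_resolution (lyub_diff K G prec) (lyub_aug G prec I).
Proof.
split=> [y||t]; [|exact: lyub_exact0|exact: lyub_exact].
have [x <-] := quot_projP y; exists [ffun=> x].
rewrite -[LHS]/(quot_proj I (\sum_s [ffun=> x : R^o] s)); congr (quot_proj I _).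
rewrite (big_pred1 empty_symbol) ?ffunE // => s.
by rewrite [s]empty_symbolP; apply/esym/eqxx.
Qed.

Lemma lyub_length_max t (S : face) : lyub_face t S -> (t <= lyub_length G prec)%N.
Proof.
move=> lS; have /andP[_ /eqP card] := lS.
have lt : (t < mu.+1)%N by rewrite ltnS -card (leq_trans (max_card _)) ?card_ord.
apply: (@leq_bigmax_cond _ (fun t : 'I_mu.+1 => 0 < #|{: symbol G prec t}|)%N
  val (Ordinal lt)).
by apply/card_gt0P; exists (Sub S lS).
Qed.

Lemma lyub_length_face : exists S : face, lyub_face (lyub_length G prec) S.
Proof.
have [|t /card_gt0P[s _] tE] := @eq_bigmax_cond _
    [pred t : 'I_mu.+1 | 0 < #|{: symbol G prec t}|]%N val.
  by apply/card_gt0P; exists ord0; apply/card_gt0P; exists empty_symbol.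
by exists (val s); rewrite /lyub_length tE; apply: (valP s).
Qed.

Lemma lyub_length_proj_resolution :
  has_proj_resolution (quot_mod I) (lyub_length G prec).
Proof.
exists (lyub_mod K G prec), (lyub_diff K G prec), (lyub_aug G prec I); split.
- by move=> t; apply: free_projective.
- exact: lyub_resolution.
move=> t lt x; apply/ffunP => s.
by have := leq_trans lt (lyub_length_max (valP s)); rewrite ltnn.
Qed.

(** If the last differential had a left inverse [h], minimality would write a
    basis vector as a combination of vectors with coefficients ['X_i]; its
    coordinate 1 would then have constant term 0. *)
Lemma minimal_lyub_length_le l :
  minimal_complex (lyub_diff K G prec) ->
  has_proj_resolution (quot_mod I) l -> (lyub_length G prec <= l)%N.
Proof.
move=> minimal res_l; rewrite leqNgt; apply/negP => lt.
have [S lS] := lyub_length_face; have := @lyub_length_max.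
case: (lyub_length G prec) lt lS => // t lt lS len_max.
pose s : symbol G prec t.+1 := Sub S lS.
have top (x : lyub_mod K G prec t.+2) : x = 0.
  by apply/ffunP => s'; have := len_max _ _ (valP s'); rewrite ltnn.
have free t' : projective (lyub_mod K G prec t') by apply: free_projective.
have [h hK] := short_resolution_splits free lyub_resolution res_l lt top.
pose x : lyub_mod K G prec t.+1 := [ffun s' => (s' == s)%:R].
have [w dx] := minimal t x.
have : (x s : R)@_0%MM = 1 by rewrite ffunE eqxx mcoeff1 eqxx.
rewrite -(hK x) dx linear_sum sum_ffunE raddf_sum big1 => [/esym/eqP|i _].
  by rewrite oner_eq0.
rewrite linearZ_LR ffunE [LHS](rmorphM (mcoeff 0%MM)) /= mcoeffX.
by rewrite mnm1_eq0 mul0r.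
Qed.

End Lyubeznik.

(** * Admissible symbols and preserved sets *)

Section Preserved.
Variables (n : nat) (G : {fset 'X_{1..n}}) (prec : rel 'X_{1..n}).
Hypothesis ord : total_order_on G prec.
Hypothesis antichain : {in G &, forall m m', (m <= m')%MM -> m = m'}.
Local Notation mu := (#|` G|).
Local Notation face := {set 'I_mu}.
Local Notation gen := (@gen n G prec).
Local Notation lcm := (@lcm_gens n G prec).
Local Notation admissible := (@admissible n G prec).

Lemma sort_sorted_sub (A : {fset 'X_{1..n}}) :
  (A `<=` G)%fset -> sorted prec (sort prec A).
Proof.
move=> /fsubsetP AG; have [_ _ tot] := ord.
by apply: (sort_sorted_in tot); apply/allP.
Qed.

Lemma prec_refl : {in G, reflexive prec}.
Proof. by have [_ _ tot] := ord => m mG; have := tot _ _ mG mG; rewrite orbb. Qed.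

Lemma prec_gen (i j : 'I_mu) : prec (gen i) (gen j) = (i <= j)%N.
Proof.
have [anti tr tot] := ord.
have mono (a b : 'I_mu) : (a <= b)%N -> prec (gen a) (gen b).
  move=> ab; apply: (sorted_leq_nth_in tr prec_refl) ab.
  - by apply/allP => m; rewrite mem_sort.
  - exact: sort_sorted_sub.
  - by rewrite inE size_sort.
  - by rewrite inE size_sort.
apply/idP/idP => [ij|]; last exact: mono.
rewrite leqNgt; apply/negP => ji.
have /gen_inj eqij : gen i = gen j.
  by apply: anti; rewrite ?gen_in // ij mono // ltnW.
by rewrite eqij ltnn in ji.
Qed.

Lemma fset_lcmP (A : {fset 'X_{1..n}}) m :
  reflect {in A, forall u, (u <= m)%MM} (fset_lcm A <= m)%MM.
Proof.
rewrite /fset_lcm (big_morph (fun x => (x <= m)%MM) (lem_mlcm m) (lem0m m)).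
by rewrite big_all; apply: allP.
Qed.

Lemma fset_leastP (A : {fset 'X_{1..n}}) : (A `<=` G)%fset -> A != fset0 ->
  fset_least prec A \in A /\ {in A, forall u, prec (fset_least prec A) u}.
Proof.
move=> AG A0; have sorA := sort_sorted_sub AG; rewrite /fset_least.
have memA m : (m \in sort prec A) = (m \in A) by rewrite mem_sort.
case: (sort prec A) sorA memA => [|a s] /= sor memA.
  by case/fset0Pn: A0 => m mA; have := memA m; rewrite mA.
split=> [|u]; first by rewrite -memA mem_head.
have [_ tr _] := ord; have aA : a \in A by rewrite -memA mem_head.
rewrite -memA inE => /predU1P[->|us].
  exact: prec_refl (fsubsetP AG _ aA).
have /allP : all (prec a) s; last exact.
apply: (order_path_min_in tr) sor.
apply/allP => v vs; apply: (fsubsetP AG).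
by rewrite -memA.
Qed.

Definition gens (S : face) : {fset 'X_{1..n}} := [fset gen i | i in S]%fset.

Lemma gensP (S : face) m : reflect (exists2 i, i \in S & m = gen i) (m \in gens S).
Proof. exact: imfsetP. Qed.

Lemma gens_sub (S : face) : (gens S `<=` G)%fset.
Proof. by apply/fsubsetP => m /gensP[i _ ->]; apply: gen_in. Qed.

Lemma card_gens (S : face) : #|` gens S| = #|S|.
Proof. by rewrite card_imfset ?cardE //; apply: gen_inj. Qed.

Lemma gens_preim (A : {fset 'X_{1..n}}) : (A `<=` G)%fset ->
  gens [set i | gen i \in A] = A.
Proof.
move=> /fsubsetP AG; apply/fsetP => m; apply/gensP/idP => [[i]|mA].
  by rewrite inE => iA ->.
by have [i im] := gen_onto prec (AG _ mA); exists i; rewrite ?inE im.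
Qed.

(** The antichain hypothesis serves when the least element of a broken subset
    is the last element of [S], where admissibility imposes nothing: the subset
    is then a singleton, broken only by a proper divisor of its element. *)
Lemma preserved_admissible (S : face) :
  preserved G prec (gens S) = admissible S.
Proof.
rewrite /preserved gens_sub; apply/allP/admissibleP => [unbroken i k q iS kS ik qi|adm D].
  pose T := [set j in S | (i <= j)%N]; apply/negP => le.
  have iT : i \in T by rewrite inE iS leqnn.
  have T0 : gens T != fset0 by apply/fset0Pn; exists (gen i); apply/gensP; exists i.
  have /unbroken/negP[] : gens T \in fpowerset (gens S).
    rewrite fpowersetE; apply/fsubsetP => m /gensP[j /[!inE] /andP[jS _] ->].
    by apply/gensP; exists j.
  have [/gensP[j jT leastE] min] := fset_leastP (gens_sub T) T0.
  have {}leastE : fset_least prec (gens T) = gen i.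
    have : prec (gen j) (gen i) by rewrite -leastE min //; apply/gensP; exists i.
    rewrite prec_gen leastE => ji; congr gen; apply/val_inj/eqP.
    by rewrite eqn_leq ji; move: jT; rewrite inE => /andP[].
  rewrite /broken T0 gens_sub; apply/hasP; exists (gen q); first exact: gen_in.
  rewrite leastE prec_gen (ltnW qi) (inj_eq (@gen_inj _ _ _)) neq_ltn qi andbT.
  apply: lepm_trans le _; apply/lcm_gensP => l lT.
  by apply: (fset_lcmP _ _ (lepm_refl _)); apply/gensP; exists l.
rewrite fpowersetE => DS; apply/negP => /and3P[D0 DG /hasP[u uG /and3P[uD]]].
have [/(fsubsetP DS)/gensP[i iS ->] min] := fset_leastP DG D0.
have [q qu] := gen_onto prec uG; rewrite -{u uG}qu in uD *.
rewrite prec_gen (inj_eq (@gen_inj _ _ _)) -val_eqE => qi neq.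
have {qi neq} lt_qi : (q < i)%N by rewrite ltn_neqAle neq.
have Dge m : m \in D -> exists j, [/\ j \in S, (i <= j)%N & m = gen j].
  move=> mD; have /gensP[j jS mj] := fsubsetP DS _ mD.
  by exists j; split=> //; have := min _ mD; rewrite mj prec_gen.
have [/exists_inP[k kS ik]|] := boolP [exists k in S, (i < k)%N].
  have /negP[] := adm i k q iS kS ik lt_qi; apply: lepm_trans uD _.
  apply/fset_lcmP => m /Dge[j [jS ij ->]]; apply: gen_le_lcm.
  by rewrite inE jS.
move=> /exists_inPn last_i; have qi : (gen q <= gen i)%MM.
  apply: lepm_trans uD _; apply/fset_lcmP => m /Dge[j [jS ij ->]].
  have ji : j = i by apply/val_inj/eqP; rewrite eqn_leq ij leqNgt last_i.
  by rewrite ji lepm_refl.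
have /gen_inj eq_qi := antichain (gen_in prec q) (gen_in prec i) qi.
by rewrite eq_qi ltnn in lt_qi.
Qed.

Lemma lyub_length_ps : lyub_length G prec = ps_order G prec.
Proof.
apply/eqP; rewrite eqn_leq; apply/andP; split.
  have [S /andP[adm /eqP card]] := lyub_length_face G prec.
  rewrite -card -card_gens; apply: leq_bigmax_seq; first by rewrite fpowersetE gens_sub.
  by rewrite preserved_admissible.
apply/bigmax_leqP_seq => A; rewrite fpowersetE => /gens_preim <-.
rewrite preserved_admissible card_gens => adm.
by apply: (lyub_length_max (S := [set i | gen i \in A])); rewrite /lyub_face adm eqxx.
Qed.

End Preserved.

(** * The theorem *)

(** A generator that is a multiple of a generator in [T] can be replaced by it. *)
Lemma generates_sub (K : fieldType) (n : nat) (I : submodClosed {mpoly K[n]}^o)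
    (S T : 'X_{1..n} -> Prop) :
  generates S I -> (forall m, T m -> S m) ->
  (forall m, S m -> exists2 m', T m' & (m' <= m)%MM) -> generates T I.
Proof.
move=> gS TS below p; split=> [/gS[s sS ->] | [s sT ->]]; last first.
  by apply/gS; exists s => // x /sT/TS.
elim: s sS => [|x s IH] sS; first by exists [::]; rewrite ?big_nil.
have [y ys|u uT uE] := IH; first by apply: sS; rewrite inE ys orbT.
have [m mT mx] := below _ (sS _ (mem_head _ _)).
exists ((x.1 * 'X_[x.2 - m], m) :: u) => [y|].
  by rewrite inE => /predU1P[->|/uT].
by rewrite !big_cons uE -mulrA -mpolyXD submK.
Qed.

Lemma mingens_antichain (K : fieldType) (n : nat)
    (I : submodClosed {mpoly K[n]}^o) (G : {fset 'X_{1..n}}) :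
  is_mingens I G -> {in G &, forall m m', (m <= m')%MM -> m = m'}.
Proof.
move=> [gensG minG] m m' mG m'G le; apply/eqP/negPn/negP => ne.
have proper : (G `\ m' `<` G)%fset by apply: fproperD1.
apply: (minG _ proper); apply: generates_sub gensG _ _ => [a|a aG].
  by rewrite !inE => /andP[].
have [->|nea] := eqVneq a m'; first by exists m; rewrite // !inE ne.
by exists a; rewrite ?lepm_refl // !inE nea.
Qed.

Theorem corollary5p6 (K : fieldType) (n : nat) (I : submodClosed {mpoly K[n]}^o)
    (I_monomial : monomial_ideal I)
    (I_lyubeznik : lyubeznik_ideal I \/ almost_lyubeznik_ideal I) :
  projdim (quot_mod I) = Some (lyub_number I) /\ lyub_number I = ps_number I.
Proof.
have mingensI := mingensP I_monomial; have [gensI _] := mingensI.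
have length_ps prec : total_order_on (mingens I) prec ->
    lyub_length (mingens I) prec = ps_order (mingens I) prec.
  by move=> ord; apply: lyub_length_ps ord (mingens_antichain mingensI).
have [[precL ordL LE] Lmin] := lyub_numberP I.
split; last first.
  have [[precS ordS SE] Smin] := ps_numberP I.
  apply/eqP; rewrite eqn_leq -{1}SE -length_ps // Lmin //.
  by rewrite -LE length_ps // Smin.
case: I_lyubeznik => // -[prec [ord _ minimal]].
have resL : has_proj_resolution (quot_mod I) (lyub_number I).
  by rewrite -LE; apply: lyub_length_proj_resolution.
rewrite /projdim; case: excluded_middle_informative => [ex|[]];
  last by exists (lyub_number I).
have [resm le] := nat_minP ex; congr Some; apply/eqP; rewrite eqn_leq le //=.
apply: leq_trans (Lmin _ ord) _.
exact: minimal_lyub_length_le gensI _ minimal resm.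
Qed.
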